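(* Every tight affine vector space partition of length $n\ge 1$ has size at least $n+1$.
   Context: Identify $\{0,1\}^n$ with $\mathbb{F}_2^n$. An affine vector space partition of length $n$ is a partition of $\mathbb{F}_2^n$ into affine subspaces $x+V$ ($V$ a linear subspace, called the linear part); its size is the number of affine subspaces. It is tight if the intersection of the linear parts of all its affine subspaces is $\{0^n\}$. *)

(* Defs.v *)
From HB Require Import structures.
From mathcomp Require Import all_boot all_order all_algebra.

Set Implicit Arguments.
Unset Strict Implicit.
Unset Printing Implicit Defensive.

Import GRing.Theory.
Local Open Scope ring_scope.

Section AffineVectorSpacePartitions.

Variable n : nat.
Implicit Types (x y v : 'rV['F_2]_n) (V W : {vspace 'rV['F_2]_n}).
Implicit Types (A : {set 'rV['F_2]_n}) (P : {set {set 'rV['F_2]_n}}).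

Definition translate x V : {set 'rV['F_2]_n} := [set x + v | v in V].

(* A relation rather than a function of A; V is determined by A, see
   linear_part_uniq. *)
Definition linear_part A V : Prop := exists x, A = translate x V.

Definition affine_subspace A : Prop := exists V, linear_part A V.

Definition affine_vspace_partition P : Prop :=
  partition P [set: 'rV['F_2]_n] /\ (forall A, A \in P -> affine_subspace A).

Definition in_all_linear_parts P v : Prop :=
  forall A V, A \in P -> linear_part A V -> v \in V.

Definition tight P : Prop := forall v, in_all_linear_parts P v <-> v = 0.

Lemma linear_part_uniq A V W : linear_part A V -> linear_part A W -> V = W.
Proof.
move=> [x ->] [y]; suff sub x' y' V' W' :
    translate x' V' = translate y' W' -> (V' <= W')%VS.
  by move=> e; apply/eqP; rewrite eqEsubv (sub _ _ _ _ e) (sub _ _ _ _ (esym e)).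
move=> /setP e; apply/subvP => v Vv.
have /imsetP[w Ww xE]: x' \in translate y' W'.
  by rewrite -e; apply/imsetP; exists 0; rewrite ?mem0v ?addr0.
have /imsetP[u Wu xvE]: x' + v \in translate y' W'.
  by rewrite -e; apply/imsetP; exists v.
have -> : v = u - w.
  by apply: (addrI x'); rewrite xvE xE -addrA (addrC w) subrK.
exact: memvB.
Qed.

End AffineVectorSpacePartitions.

(* Main.v *)
(** Write the parts as cosets [a_i + V_i], and for a set [J] of parts let [V_J]
    be the intersection of the [V_i] with [i] in [J].  Suppose there are at most
    [n] parts, and let [J] be a maximal proper subset of the parts with
    [n <= dim V_J + |J|].  Maximality and tightness yield a Hall condition for
    the traces on [V_J] of the parts outside [J], so every coset of [V_J]
    contains a point missed by all these parts (an affine form of Rado's theorem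
    on independent transversals).  Apply this to the coset of a point [x] of a
    part outside [J]: the parts in [J] miss [x], hence miss the whole coset, and
    some point is not covered. *)
Require Import Defs.
From mathcomp Require Import all_boot all_order all_algebra.

Set Implicit Arguments.
Unset Strict Implicit.
Unset Printing Implicit Defensive.

Import GRing.Theory.
Local Open Scope ring_scope.

Section AvoidingCosets.

Variables (F : fieldType) (vT : vectType F).

(** Take [H] to be [W] plus a complement in [U] of [W + <[u]>]. This serves to dodge a single coset
    by passing to a translate of [H], at the cost of at most one dimension. *)
Lemma hyperplane_avoiding (U W : {vspace vT}) (u : vT) :
  (W <= U)%VS -> u \in U -> u \notin W ->
  exists H : {vspace vT},
    [/\ (W <= H)%VS, (H <= U)%VS, u \notin H & (\dim U <= (\dim H).+1)%N].
Proof.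
move=> WU uU uW; pose X := (W + <[u]>)%VS; pose D := (U :\: X)%VS.
have XU : (X <= U)%VS by rewrite subv_add WU -memvE.
have DX0 : (D :&: X)%VS = 0%VS by apply: capv_diff.
exists (W + D)%VS; split.
- exact: addvSl.
- by rewrite subv_add WU diffvSl.
- apply: contra uW => /memv_addP[w wW [d dD uE]].
  suff d0 : d = 0 by rewrite uE d0 addr0.
  apply/eqP; rewrite -memv0 -DX0 memv_cap dD /=.
  have -> : d = - w + u by rewrite uE addKr.
  by rewrite memv_add ?memvN // memv_line.
- have WD0 : (W :&: D)%VS = 0%VS.
    apply/eqP; rewrite -subv0 -DX0 capvC.
    by rewrite capvS // addvSl.
  rewrite dimv_disjoint_sum // -(dimv_cap_compl U X).
  rewrite -/D (capv_idPr XU) addnC -addSn addnC leq_add2r.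
  apply: leq_trans (dimv_add_leqif _ _) _.
  by rewrite dim_vline -addn1 leq_add2l leq_b1.
Qed.

Variables (I : finType) (V : I -> {vspace vT}) (a : I -> vT).

Lemma memv_bigcapP (J : {set I}) (v : vT) :
  reflect (forall i, i \in J -> v \in V i) (v \in \bigcap_(i in J) V i)%VS.
Proof. by rewrite memvE; apply: (iffP subv_bigcapP). Qed.

Lemma bigcapv_setU (J K : {set I}) :
  (\bigcap_(i in J :|: K) V i
    = (\bigcap_(i in J) V i) :&: (\bigcap_(i in K) V i))%VS.
Proof.
apply/vspaceP => v; rewrite memv_cap; apply/memv_bigcapP/andP.
  by move=> h; split; apply/memv_bigcapP => i iJ; apply: h; rewrite inE iJ ?orbT.
by case=> /memv_bigcapP hJ /memv_bigcapP hK i /setUP[/hJ|/hK].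
Qed.

(* The induction is that of Halmos and Vaughan for Hall's marriage theorem. *)
Lemma avoid_cosets (S : {set I}) (U : {vspace vT}) (x : vT) :
  (forall J : {set I}, J \subset S ->
     (\dim (U :&: \bigcap_(i in J) V i) + #|J| <= \dim U)%N) ->
  exists2 u, u \in U & forall i, i \in S -> x + u - a i \notin V i.
Proof.
have [m] := ubnP #|S|; elim: m S U x => // m IHm S U x ltSm hall.
have [S0 | [i iS]] := set_0Vmem S.
  by exists 0; [exact: mem0v | move=> i; rewrite S0 inE].
case: (pickP (fun J : {set I} => [&& J != set0, J \proper S &
    \dim U == (\dim (U :&: \bigcap_(i in J) V i) + #|J|)%N]))
  => [J /and3P[J0 JpS /eqP dimJ] | noJ].
  have JS := proper_sub JpS.
  have [|K KJ|u uU hu] := IHm J U x.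
  - by have := leq_trans (proper_card JpS) (ltSm : #|S| <= m)%N.
  - exact: hall (subset_trans KJ JS).
  (* Shifts by elements of this intersection keep the cosets indexed by [J] avoided, and the
     equality [dimJ] turns the Hall condition for [J :|: K] into the one for [K]. *)
  have [||w] := IHm (S :\: J) (U :&: \bigcap_(i in J) V i)%VS (x + u).
  - apply: leq_trans (ltSm : #|S| <= m)%N.
    by rewrite cardsDS // ltn_subrL !card_gt0 J0; apply/set0Pn; exists i.
  - move=> K; rewrite subsetD => /andP[KS dJK].
    rewrite -capvA -bigcapv_setU -(leq_add2r #|J|) -dimJ -addnA.
    have -> : (#|K| + #|J| = #|J :|: K|)%N.
      by rewrite cardsU setIC disjoint_setI0 // cards0 subn0 addnC.
    by apply: hall; rewrite subUset JS.
  rewrite memv_cap => /andP[wU /memv_bigcapP wV] hw.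
  exists (u + w); first exact: memvD.
  move=> j jS; rewrite addrA; have [jJ | jJ] := boolP (j \in J).
    by rewrite (addrAC _ w) (rpredDr _ (wV j jJ)) hu.
  by apply: hw; rewrite inE jJ.
have [u uU uV] : exists2 u, u \in U & u \notin V i.
  apply/subvPn; apply/negP => UV.
  have := hall [set i]; rewrite sub1set big_set1 cards1 (capv_idPl UV) addn1.
  by move=> /(_ iS); rewrite ltnn.
have [||H [WH HU uH dimH]] := @hyperplane_avoiding U (U :&: V i)%VS u _ uU.
- exact: capvSl.
- by rewrite memv_cap negb_and uV orbT.
(* As [H] contains [U :&: V i], the trace of [a i + V i] on [x + U] lies in a single translate of
   [H]. If [x + H] meets it, then [x + u + H] does not, because [u] is outside [H]; otherwise
   [y = 0] works. *)
have [y yU hy] : exists2 y, y \in U &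
    forall h, h \in H -> x + y + h - a i \notin V i.
  have [/memv_addP[v vV [h hH xE]] | xVH] := boolP (x - a i \in V i + H)%VS.
    exists u => // k kH; apply: contra uH => xuk.
    have uhk : u + (h + k) \in V i.
      suff -> : u + (h + k) = x + u + k - a i - v by exact: memvB.
      have -> : x + u + k - a i = u + k + (x - a i) by rewrite (addrC x) (addrAC u) -(addrA _ x).
      by rewrite xE (addrC v) (addrA _ h v) addrK -addrA (addrC k).
    have -> : u = u + (h + k) - (h + k) by rewrite addrK.
    have hkH : h + k \in H by exact: memvD.
    apply: memvB => //; apply: (subvP WH).
    by rewrite memv_cap uhk andbT memvD // (subvP HU).
  exists 0; first exact: mem0v.
  move=> h hH; apply: contra xVH => xh; rewrite addr0 addrAC in xh.
  by rewrite -(addrK h (x - a i)) memv_add ?memvN.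
have [||w wH hw] := IHm (S :\ i) H (x + y).
- by rewrite (cardsD1 i S) iS in ltSm.
- move=> K KS; have [-> | K0] := eqVneq K set0.
    by rewrite cards0 addn0 dimvS // capvSl.
  have iK : i \notin K.
    by apply/negP => /(subsetP KS); rewrite !inE eqxx.
  have KpS : K \proper S.
    rewrite properE (subset_trans KS (subsetDl _ _)).
    by apply/subsetPn; exists i.
  (* No nonempty proper subset of [S] attains equality in the Hall condition, and this slack of one
     pays for the dimension lost in [H]. *)
  have := noJ K; rewrite K0 KpS /= => /negbT neq.
  have := hall K (proper_sub KpS); rewrite leq_eqVlt eq_sym (negPf neq) /=.
  move=> lt; rewrite -ltnS; apply: leq_trans dimH; apply: leq_trans lt.
  by rewrite ltnS leq_add2r dimvS // capvS.
exists (y + w); first by rewrite memvD // (subvP HU).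
move=> j jS; rewrite addrA; have [-> | ji] := eqVneq j i; first exact: hy.
by apply: hw; rewrite !inE ji.
Qed.

End AvoidingCosets.

Theorem theorem4p8 (n : nat) (n_ge1 : (1 <= n)%N)
    (P : {set {set 'rV['F_2]_n}})
    (P_avsp : affine_vspace_partition P) (P_tight : tight P) :
  (n + 1 <= #|P|)%N.
Proof.
have [partP affP] := P_avsp.
have dimE : \dim {:'rV['F_2]_n} = n by rewrite dimvf /dim /= mul1n.
have /fin_all_exists[c cE] (A : {set 'rV['F_2]_n}) :
    exists c : {vspace 'rV['F_2]_n} * 'rV['F_2]_n,
      A \in P -> A = translate c.2 c.1.
  have [/affP[V [x AE]] | //] := boolP (A \in P); first by exists (V, x).
  by exists (0%VS, 0).
pose V A := (c A).1; pose a A := (c A).2.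
have memA A x : A \in P -> (x \in A) = (x - a A \in V A).
  move=> AP; rewrite {1}(cE A AP); apply/imsetP/idP => [[v vV ->] | xV].
    by rewrite addrC addKr.
  by exists (x - a A) => //; rewrite addrC subrK.
have capV0 : (\bigcap_(A in P) V A)%VS = 0%VS.
  apply/eqP; rewrite -subv0; apply/subvP => v /memv_bigcapP vV.
  rewrite memv0; apply/eqP; apply/P_tight => A W AP AW.
  (* Tightness speaks of every linear part of [A], while [V A] is a chosen one. *)
  suff -> : W = V A by exact: vV.
  by apply: linear_part_uniq AW _; exists (a A); exact: cE.
have coverP x : exists2 A, A \in P & x \in A.
  by apply/bigcupP; have /and3P[/eqP + _ _] := partP; rewrite /cover => ->.
have P_gt0 : set0 \proper P.
  have [A AP _] := coverP 0.
  by rewrite proper0; apply/set0Pn; exists A.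
rewrite addn1 ltnNge; apply/negP => Pn.
pose big (J : {set {set 'rV['F_2]_n}}) :=
  (J \proper P) && (n <= \dim (\bigcap_(A in J) V A)%VS + #|J|)%N.
have big0 : big set0 by rewrite /big P_gt0 big_set0 dimE leq_addr.
case: (arg_maxnP (fun J : {set {set 'rV['F_2]_n}} => #|J|) big0) => J /andP[JpP nJ] maxJ.
have [JP [B BP BJ]] := properP JpP.
have [x xB] : exists x, x \in B.
  by apply/set0Pn; apply: contraTneq BP => ->; have /and3P[] := partP.
have [|u /memv_bigcapP uV hu] :=
    @avoid_cosets _ _ _ V a (P :\: J) (\bigcap_(A in J) V A)%VS x.
  move=> K; rewrite subsetD => /andP[KP dKJ].
  have [-> | K0] := eqVneq K set0.
    by rewrite cards0 addn0 dimvS // capvSl.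
  have cardJK : #|J :|: K| = (#|J| + #|K|)%N.
    by rewrite cardsU setIC disjoint_setI0 // cards0 subn0.
  rewrite -bigcapv_setU -(leq_add2r #|J|) -addnA (addnC #|K|) -cardJK.
  (* It suffices to bound the left side by [n]. If [J :|: K] is all of [P], its intersection is zero
     and [#|P| <= n]. Otherwise, exceeding [n] would make it a [big] set larger than [J], as [K] is
     nonempty. *)
  apply: leq_trans nJ; have [-> | JKP] := eqVneq (J :|: K) P.
    by rewrite capV0 dimv0.
  have JKpP : J :|: K \proper P by rewrite properEneq JKP subUset JP.
  rewrite leqNgt; apply/negP => /ltnW nJK.
  have := maxJ (J :|: K); rewrite /big JKpP nJK => /(_ isT).
  by rewrite /= cardJK -subn_eq0 addKn cards_eq0 (negPf K0).
have [A AP xuA] := coverP (x + u).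
have [AJ | AJ] := boolP (A \in J); last first.
  by have := hu A; rewrite inE AJ AP -memA // xuA => /(_ isT).
have xA : x \in A.
  rewrite memA // -(addrK u x) addrAC rpredB ?uV //.
  by rewrite -memA.
have /and3P[_ /trivIsetP tI _] := partP.
have AB : A != B by apply: contraNneq BJ => <-.
by have /disjointFr/(_ xA) := tI A B AP BP AB; rewrite xB.
Qed.
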